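(* Let $E$ and $F$ be order continuous Banach lattices. If a net $(x_{\alpha})\subseteq E$ is $uaw$-convergent to $x\in E$ and a net $(y_{\beta})\subseteq F$ is $uaw$-convergent to $y\in F$, then the double net $(x_{\alpha}\otimes y_{\beta})_{(\alpha,\beta)}$ is $uaw$-convergent to $x\otimes y$ in the Fremlin projective tensor product $E\widehat{\otimes}F$.
   Context: Banach lattices are real. For Archimedean vector lattices $E,F$, the Fremlin tensor product $E\overline{\otimes}F$ is the Archimedean vector lattice containing the algebraic tensor product $E\otimes F$ as a vector subspace, generated by it as a vector lattice, such that $(x,y)\mapsto x\otimes y$ is a lattice bimorphism and every lattice bimorphism from $E\times F$ into an Archimedean vector lattice factors uniquely through a lattice homomorphism on $E\overline{\otimes}F$. For Banach lattices $E,F$, the Fremlin projective tensor product $E\widehat{\otimes}F$ is the Banach lattice obtained as the completion of $E\otimes F$ (equivalently of $E\overline{\otimes}F$, which is a norm-dense vector sublattice) under the positive projective norm $\|\cdot\|_{|\pi|}$, given on $E\overline{\otimes}F$ by $\|u\|_{|\pi|}=\inf\{\sum_{i=1}^n\|x_i\|\|y_i\| : n\in\mathbb N,\ x_i\in E_+,\ y_i\in F_+,\ |u|\le\sum_{i=1}^n x_i\otimes y_i\}$; it is a lattice norm with $\|x\otimes y\|_{|\pi|}=\|x\|\|y\|$. A Banach lattice is order continuous if every net decreasing to $0$ in order is norm convergent to $0$. A net $(x_\alpha)$ in a Banach lattice $X$ is $uaw$-convergent (unbounded absolutely weakly convergent) to $x\in X$ if $|x_\alpha-x|\wedge u\to 0$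 weakly for every $u\in X_+$. A double net $(x_\alpha\otimes y_\beta)$ is indexed by the pairs $(\alpha,\beta)$ with the product (coordinatewise) direction. *)

(* Defs.v *)
From HB Require Import structures.
From mathcomp Require Import all_boot all_order all_algebra.
From mathcomp Require Import all_classical all_reals all_analysis.

Set Implicit Arguments.
Unset Strict Implicit.
Unset Printing Implicit Defensive.

Import Order.TTheory GRing.Theory Num.Theory.
Import numFieldNormedType.Exports.

Local Open Scope classical_set_scope.
Local Open Scope ring_scope.

(* The order is part of this interface, instead of being inherited from
   [Order.POrder], because Hierarchy Builder refuses any structure that extends
   both [Order.POrder] and a normed module: [Num.NumDomain] already joins orders
   and norms without an intermediate structure. *)
HB.mixin Record isVectorLattice (R : realType) E of GRing.Lmodule R E := {
  vle : rel E ;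
  vjoin : E -> E -> E ;
  vmeet : E -> E -> E ;
  vle_refl : reflexive vle ;
  vle_anti : antisymmetric vle ;
  vle_trans : transitive vle ;
  vleUx : forall x y z : E, vle (vjoin x y) z = vle x z && vle y z ;
  vlexI : forall x y z : E, vle z (vmeet x y) = vle z x && vle z y ;
  vleD2r : forall z x y : E, vle x y -> vle (x + z) (y + z) ;
  vscaler_ge0 : forall (a : R) (x : E), 0 <= a -> vle 0 x -> vle 0 (a *: x)
}.

#[short(type="vectorLatticeType")]
HB.structure Definition VectorLattice (R : realType) :=
  {E of GRing.Lmodule R E & isVectorLattice R E}.

Notation "x <=L y" := (vle x y) (at level 70, y at next level) : ring_scope.

(* The lattice modulus; [`| x |] is reserved for the norm. *)
Definition vabs (R : realType) (E : vectorLatticeType R) (x : E) : E :=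
  vjoin x (- x).

HB.mixin Record hasLatticeNorm (R : realType) E
    of CompleteNormedModule R E & VectorLattice R E := {
  le_lattice_norm : forall x y : E, vabs x <=L vabs y -> `|x| <= `|y|
}.

#[short(type="banachLatticeType")]
HB.structure Definition BanachLattice (R : realType) :=
  {E of CompleteNormedModule R E & VectorLattice R E & hasLatticeNorm R E}.

Section Nets.
Context {d : Order.disp_t} (I : preorderType d).

Definition directed : Prop :=
  inhabited I /\ forall i j : I, exists k : I, (i <= k)%O && (j <= k)%O.

(* Convergence of a net [u : I -> T] to [l] is [u @ tails I --> l]. *)
Definition tails : set_system I :=
  filter_from [set: I] (fun i => [set j | (i <= j)%O]).

End Nets.

Arguments tails {d} I.

Definition order_continuous (R : realType) (E : banachLatticeType R) : Prop :=
  forall (d : Order.disp_t) (I : preorderType d) (u : I -> E),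
    directed I ->
    (forall i j : I, (i <= j)%O -> u j <=L u i) ->
    (forall i : I, 0 <=L u i) ->
    (forall z : E, (forall i : I, z <=L u i) -> z <=L 0) ->
    u @ tails I --> (0 : E).

Definition weakly_cvg (R : realType) (X : normedModType R)
    (d : Order.disp_t) (I : preorderType d) (u : I -> X) (l : X) : Prop :=
  forall f : {linear X -> R^o}, continuous f ->
    (fun i => f (u i)) @ tails I --> f l.

Definition uaw_cvg (R : realType) (X : banachLatticeType R)
    (d : Order.disp_t) (I : preorderType d) (x : I -> X) (l : X) : Prop :=
  forall u : X, 0 <=L u ->
    weakly_cvg (fun i => vmeet (vabs (x i - l)) u) 0.

Definition archimedean (R : realType) (E : vectorLatticeType R) : Prop :=
  forall x y : E, 0 <=L x -> (forall n : nat, x *+ n <=L y) -> x = 0.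

Definition bilinear_map (R : realType) (U V W : lmodType R)
    (b : U -> V -> W) : Prop :=
  (forall v, linear (b^~ v)) /\ (forall u, linear (b u)).

Definition lattice_hom (R : realType) (E F : vectorLatticeType R)
    (T : E -> F) : Prop :=
  [/\ linear T, {morph T : x y / vjoin x y} & {morph T : x y / vmeet x y}].

Definition lattice_bimorphism (R : realType) (E F G : vectorLatticeType R)
    (b : E -> F -> G) : Prop :=
  [/\ bilinear_map b,
      forall y : F, 0 <=L y -> lattice_hom (b^~ y)
    & forall x : E, 0 <=L x -> lattice_hom (b x)].

(* The linear span of the [t u v] in [W] is the algebraic tensor product of
   [U] and [V]: every element of the span is a finite sum of elementary
   tensors, and the last clause says that every bilinear map [b] factors
   through a map that is (necessarily) linear on that span. *)
Definition spans_tensor_product (R : realType) (U V W : lmodType R)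
    (t : U -> V -> W) : Prop :=
  bilinear_map t /\
  forall (Z : lmodType R) (b : U -> V -> Z), bilinear_map b ->
    exists L : W -> Z, forall (n : nat) (u : 'I_n -> U) (v : 'I_n -> V),
      L (\sum_(i < n) t (u i) (v i)) = \sum_(i < n) b (u i) (v i).

Definition vector_sublattice (R : realType) (E : vectorLatticeType R)
    (S : set E) : Prop :=
  [/\ S 0,
      forall (a : R) (x y : E), S x -> S y -> S (a *: x + y),
      forall x y : E, S x -> S y -> S (vjoin x y)
    & forall x y : E, S x -> S y -> S (vmeet x y)].

Definition fremlin_tensor (R : realType) (E F A : vectorLatticeType R)
    (t : E -> F -> A) : Prop :=
  [/\ archimedean A,
      spans_tensor_product t,
      forall S : set A, vector_sublattice S ->
        (forall x y, S (t x y)) -> S = setT,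
      lattice_bimorphism t
    & forall (B : vectorLatticeType R) (b : E -> F -> B),
        archimedean B -> lattice_bimorphism b ->
        exists! T : A -> B,
          lattice_hom T /\ forall x y, T (t x y) = b x y].

Definition pos_proj_norm (R : realType) (E F : banachLatticeType R)
    (A : vectorLatticeType R) (t : E -> F -> A) (w : A) : R :=
  inf [set r : R | exists (n : nat) (x : 'I_n -> E) (y : 'I_n -> F),
    [/\ forall i, 0 <=L x i,
        forall i, 0 <=L y i,
        vabs w <=L \sum_(i < n) t (x i) (y i)
      & r = \sum_(i < n) `|x i| * `|y i|]].

(* [G], with elementary tensors [t], is a completion of the Fremlin tensor
   product [A] of [E] and [F] for the positive projective norm, [iota] being
   the canonical embedding of [A]. *)
Definition fremlin_projective_tensor (R : realType) (E F G : banachLatticeType R)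
    (t : E -> F -> G) : Prop :=
  exists (A : vectorLatticeType R) (tA : E -> F -> A) (iota : A -> G),
    [/\ fremlin_tensor tA,
        lattice_hom iota,
        forall w : A, `|iota w| = pos_proj_norm tA w,
        dense (range iota)
      & forall x y, t x y = iota (tA x y)].

(* Main.v *)
(**
In an order continuous Banach lattice [E], an order bounded positive net that
converges weakly to [0] converges in norm (see [weakly_cvg0_norm]); hence
[|x_i - x0| /\ u] and [|y_j - y0| /\ v] are null in norm for all [u] and [v].
This passes to the tensor product, which need not be order continuous, by
inequalities valid for every lattice bimorphism [t]:
[t a v /\ t u v = t (a /\ u) v] for [v >= 0], and
[t a b /\ t u v <= t (a /\ u) v + t u (b /\ v)] for positive arguments. They apply because
[x (x) y - x0 (x) y0] is dominated by [a (x) b + a (x) |y0| + |x0| (x) b] with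
[a = |x - x0|], [b = |y - y0|], and every positive element of the completion
lies below some [u (x) v] up to an element of small norm. The convergence
obtained is thus in norm, a fortiori weak.
*)
Require Import Defs.
From HB Require Import structures.
From mathcomp Require Import all_boot all_order all_algebra.
From mathcomp Require Import all_classical all_reals all_analysis.
From mathcomp Require Import lra.

Set Implicit Arguments.
Unset Strict Implicit.
Unset Printing Implicit Defensive.

Import Order.TTheory GRing.Theory Num.Theory.
Import numFieldNormedType.Exports.

Local Open Scope classical_set_scope.
Local Open Scope ring_scope.

(** * Vector lattices *)

Section VectorLatticeTheory.
Context (R : realType) (E : vectorLatticeType R).
Implicit Types x y z w : E.

Lemma vle_ltrans y x z : x <=L y -> y <=L z -> x <=L z.
Proof. exact: vle_trans. Qed.

Lemma vle_eq x y : x <=L y -> y <=L x -> x = y.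
Proof. by move=> xy yx; apply: vle_anti; rewrite xy yx. Qed.

Lemma vleD2rE z x y : (x + z <=L y + z) = (x <=L y).
Proof.
by apply/idP/idP => [/(vleD2r (- z))|/vleD2r//]; rewrite !addrK.
Qed.

Lemma vleD2lE z x y : (z + x <=L z + y) = (x <=L y).
Proof. by rewrite !(addrC z) vleD2rE. Qed.

Lemma vleBlDr x y z : (x - y <=L z) = (x <=L z + y).
Proof. by rewrite -(vleD2rE y) subrK. Qed.

Lemma vleBrDr x y z : (x <=L y - z) = (x + z <=L y).
Proof. by rewrite -(vleD2rE z) subrK. Qed.

Lemma subv_ge0 x y : (0 <=L y - x) = (x <=L y).
Proof. by rewrite vleBrDr add0r. Qed.

Lemma vleN2 x y : (- x <=L - y) = (y <=L x).
Proof. by rewrite -(vleD2rE (x + y)) addKr addrCA addNr addr0. Qed.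

Lemma vleD x y z w : x <=L y -> z <=L w -> x + z <=L y + w.
Proof. by move=> xy zw; apply: (@vle_ltrans (y + z)); rewrite ?vleD2rE ?vleD2lE. Qed.

Lemma addv_ge0 x y : 0 <=L x -> 0 <=L y -> 0 <=L x + y.
Proof. by move=> x0 y0; rewrite -[0]addr0 vleD. Qed.

Lemma vleUl x y : x <=L vjoin x y.
Proof. by have := vle_refl (vjoin x y); rewrite vleUx => /andP[]. Qed.

Lemma vleUr x y : y <=L vjoin x y.
Proof. by have := vle_refl (vjoin x y); rewrite vleUx => /andP[]. Qed.

Lemma vleIl x y : vmeet x y <=L x.
Proof. by have := vle_refl (vmeet x y); rewrite vlexI => /andP[]. Qed.

Lemma vleIr x y : vmeet x y <=L y.
Proof. by have := vle_refl (vmeet x y); rewrite vlexI => /andP[]. Qed.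

Lemma vleI2 x y z w : x <=L y -> z <=L w -> vmeet x z <=L vmeet y w.
Proof.
by move=> xy zw; rewrite vlexI (vle_ltrans (vleIl _ _))// (vle_ltrans (vleIr _ _)).
Qed.

Lemma vjoin_idr x y : x <=L y -> vjoin x y = y.
Proof. by move=> xy; apply: vle_eq; rewrite ?vleUr// vleUx xy vle_refl. Qed.

Lemma vmeetDr x y z : vmeet x y + z = vmeet (x + z) (y + z).
Proof.
apply: vle_eq; first by rewrite vlexI !vleD2rE vleIl vleIr.
by rewrite -vleBlDr vlexI !vleBlDr vleIl vleIr.
Qed.

Lemma vmeetDl_le x y z : 0 <=L z -> vmeet x (y + z) <=L vmeet x y + z.
Proof. by move=> z0; rewrite vmeetDr vleI2 ?vle_refl// -[X in X <=L _]addr0 vleD2lE. Qed.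

Lemma vmeetD_le x y z : 0 <=L x -> 0 <=L y -> 0 <=L z ->
  vmeet (x + y) z <=L vmeet x z + vmeet y z.
Proof.
move=> x0 y0 z0; rewrite -vleBlDr vlexI !vleBlDr; apply/andP; split; last first.
  by rewrite (vle_ltrans (vleIr _ _))// -[X in X <=L _]addr0 vleD2lE vlexI y0.
rewrite (addrC x (vmeet y z)) -vleBlDr vlexI !vleBlDr (addrC y) vleIl.
by rewrite (vle_ltrans (vleIr _ _))// -[X in X <=L _]addr0 vleD2lE.
Qed.

Lemma vabs_le x y : (vabs x <=L y) = (x <=L y) && (- x <=L y).
Proof. exact: vleUx. Qed.

Lemma vle_abs x : x <=L vabs x. Proof. exact: vleUl. Qed.

Lemma vleN_abs x : - x <=L vabs x. Proof. exact: vleUr. Qed.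

Lemma halfvDE z : 2^-1 *: (z + z) = z.
Proof. by rewrite -mulr2n -[z *+ 2]scaler_nat scalerA mulVf ?scale1r// pnatr_eq0. Qed.

(** Adding [x <=L vabs x] and [- x <=L vabs x] shows that twice the modulus is positive; halving
    keeps positivity. *)
Lemma vabs_ge0 x : 0 <=L vabs x.
Proof.
rewrite -(halfvDE (vabs x)) vscaler_ge0 ?invr_ge0//.
by rewrite -(subrr x) vleD ?vle_abs ?vleN_abs.
Qed.

Lemma vabsN x : vabs (- x) = vabs x.
Proof.
have h z : vabs (- z) <=L vabs z by rewrite vabs_le opprK vleN_abs vle_abs.
by apply: vle_eq; rewrite ?h// -[X in vabs X <=L _]opprK h.
Qed.

Lemma vabs_id x : 0 <=L x -> vabs x = x.
Proof.
move=> x0; apply: vle_eq; last exact: vle_abs.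
by rewrite vabs_le vle_refl (vle_ltrans _ x0)// -[0]oppr0 vleN2.
Qed.

Lemma vabsD x y : vabs (x + y) <=L vabs x + vabs y.
Proof. by rewrite vabs_le opprD !vleD ?vle_abs ?vleN_abs. Qed.

(** The witnesses are the positive and negative parts, written [(|x| + x) / 2] and [(|x| - x) / 2]
    so that both identities are linear. *)
Lemma pos_decomposition x : exists h k,
  [/\ 0 <=L h, 0 <=L k, x = h - k & vabs x = h + k].
Proof.
have h : (0 : R) <= 2^-1 by rewrite invr_ge0.
exists (2^-1 *: (vabs x + x)), (2^-1 *: (vabs x - x)); split.
- by rewrite vscaler_ge0// -vleBlDr sub0r vleN_abs.
- by rewrite vscaler_ge0// subv_ge0 vle_abs.
- by rewrite -scalerBr opprB [vabs x + x]addrC addrACA subrr addr0 halfvDE.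
- by rewrite -scalerDr addrACA subrr addr0 halfvDE.
Qed.

Definition vpos x : E := vjoin x 0.

Lemma vpos_ge0 x : 0 <=L vpos x. Proof. exact: vleUr. Qed.

Lemma vle_pos x : x <=L vpos x. Proof. exact: vleUl. Qed.

Lemma vpos_le x y : (vpos x <=L y) = (x <=L y) && (0 <=L y).
Proof. exact: vleUx. Qed.

Lemma vpos_id x : 0 <=L x -> vpos x = x.
Proof.
by move=> x0; apply: vle_eq; rewrite ?vle_pos// vpos_le vle_refl.
Qed.

Lemma vpos_eq0 x : x <=L 0 -> vpos x = 0.
Proof. exact: vjoin_idr. Qed.

End VectorLatticeTheory.

(** * The Hahn-Banach theorem for sublinear functionals *)

Section HahnBanach.
Context (R : realType) (V : lmodType R).
Implicit Types (p q : V -> R) (x y : V).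

(* Only [<=] is required in the second clause: the reverse inequality follows
   by rescaling with [a^-1]. *)
Definition sublinear p : Prop :=
  (forall x y, p (x + y) <= p x + p y) /\
  (forall a x, 0 < a -> p (a *: x) <= a * p x).

Lemma sublinearZ p (hp : sublinear p) a x : 0 <= a -> p (a *: x) = a * p x.
Proof.
case: hp => _ hZ.
(* Scaling [0] by [2] gives [0 <= p 0], scaling it by [1/2] gives [p 0 <= 0]. *)
have p0 : p 0 = 0.
  have := hZ 2 0; have := hZ 2^-1 0; rewrite !scaler0 => /(_ _) h1 /(_ _) h2.
  have := h1 ltac:(lra); have := h2 ltac:(lra); lra.
rewrite le_eqVlt => /predU1P[<-|a0]; first by rewrite scale0r mul0r.
apply/eqP; rewrite eq_le hZ//= -ler_pdivlMl//.
have {1}-> : x = a^-1 *: (a *: x) by rewrite scalerA mulVf ?scale1r// gt_eqF.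
by rewrite hZ// invr_gt0.
Qed.

Lemma sublinear0 p : sublinear p -> p 0 = 0.
Proof. by move=> hp; rewrite -(scale0r 0) sublinearZ// mul0r. Qed.

Lemma sublinear_geN p x : sublinear p -> - p (- x) <= p x.
Proof.
move=> hp; have := hp.1 x (- x).
by rewrite subrr sublinear0// -lerBlDr sub0r.
Qed.

(* [tilt q y] is the largest sublinear functional below [q] whose value at
   [- y] is at most [- q y]. *)
Definition tilt_values q y x : set R :=
  [set q (x + t *: y) - t * q y | t in [set t | 0 <= t]].
Definition tilt q y x : R := inf (tilt_values q y x).

Lemma has_inf_tilt q y x : sublinear q -> has_inf (tilt_values q y x).
Proof.
move=> hq; split; first by exists (q (x + 0 *: y) - 0 * q y), 0 => /=.
(* Subadditivity on [t y = (x + t y) + (- x)] gives this bound. *)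
exists (- q (- x)) => _ /= [t t0 <-].
have := hq.1 (x + t *: y) (- x).
by rewrite addrAC subrr add0r sublinearZ//; lra.
Qed.

Lemma tilt_le q y x t : sublinear q -> 0 <= t ->
  tilt q y x <= q (x + t *: y) - t * q y.
Proof.
by move=> hq t0; apply: ge_inf; [exact: (has_inf_tilt _ _ hq).2|exists t].
Qed.

Lemma le_tilt q y x r : sublinear q ->
  (forall t, 0 <= t -> r <= q (x + t *: y) - t * q y) -> r <= tilt q y x.
Proof.
move=> hq h; apply: lb_le_inf; first exact: (has_inf_tilt _ _ hq).1.
by move=> _ [t t0 <-]; exact: h.
Qed.

Lemma tilt_le_id q y x : sublinear q -> tilt q y x <= q x.
Proof.
move=> hq; apply: (le_trans (tilt_le y x hq (lexx 0))).
by rewrite scale0r addr0 mul0r subr0.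
Qed.

(** Parameters [t1] for [x1] and [t2] for [x2] combine into [t1 + t2] for the sum; [t] for [x]
    becomes [a * t] for [a *: x]. *)
Lemma sublinear_tilt q y : sublinear q -> sublinear (tilt q y).
Proof.
move=> hq; split=> [x1 x2|a x a0].
  rewrite -lerBlDl; apply: le_tilt => // t2 t20.
  rewrite lerBlDl -lerBlDr; apply: le_tilt => // t1 t10.
  have /le_trans := tilt_le y (x1 + x2) hq (addr_ge0 t10 t20).
  rewrite lerBlDr => h; rewrite h//.
  have := hq.1 (x1 + t1 *: y) (x2 + t2 *: y).
  by rewrite addrACA -scalerDl; lra.
rewrite -ler_pdivrMl//; apply: le_tilt => // t t0.
rewrite ler_pdivrMl// (le_trans (tilt_le _ _ hq (mulr_ge0 (ltW a0) t0)))//.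
by rewrite -scalerA -scalerDr (sublinearZ hq _ (ltW a0)) mulrBr mulrA.
Qed.

(** Zorn's lemma for the reversed pointwise order: a nonempty chain is bounded by its pointwise
    infimum, finite because every member is at least [- p (- x)] at [x]. *)
Lemma minimal_sublinear p : sublinear p -> exists2 q,
  sublinear q /\ (forall x, q x <= p x) &
  forall r, sublinear r -> (forall x, r x <= q x) -> r = q.
Proof.
move=> hp.
pose T := {q : V -> R | sublinear q /\ forall x, q x <= p x}.
pose le (q r : T) := `[< forall x, sval r x <= sval q x >].
have T_inj (q r : T) : sval q = sval r -> q = r.
  by case: q r => [q hq] [r hr] /= qr; subst r; congr exist; exact: Prop_irrelevance.
have [||||[q [hq qp]] qmin] := @Zorn T le.
- by move=> q; apply/asboolP.
- move=> q r s /asboolP rq /asboolP qs; apply/asboolP => x.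
  exact: le_trans (qs x) (rq x).
- move=> q r /asboolP qr /asboolP rq; apply: T_inj; apply/funext => x.
  by apply/eqP; rewrite eq_le qr rq.
- move=> C Ctot.
  have [[q0 Cq0]|C0] := pselect (exists s, C s); last first.
    by exists (exist _ p (conj hp (fun x => lexx (p x)))) => q Cq; exfalso; apply: C0; exists q.
  pose vals x := [set sval s x | s in C].
  pose m x := inf (vals x).
  have hm x : has_inf (vals x).
    split; first by exists (sval q0 x), q0.
    exists (- p (- x)) => _ [q Cq <-].
    have [hq qp] := svalP q.
    by apply: le_trans (sublinear_geN _ hq); rewrite lerN2.
  have m_le s x : C s -> m x <= sval s x.
    by move=> Cs; apply: ge_inf; [exact: (hm x).2|exists s].
  have le_m x r : (forall s, C s -> r <= sval s x) -> r <= m x.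
    by move=> h; apply: lb_le_inf; [exact: (hm x).1|move=> _ [q Cq <-]; exact: h].
  have sm : sublinear m.
    split=> [x y|a x a0].
      rewrite -lerBlDl; apply: (le_m) => q Cq.
      rewrite lerBlDl -lerBlDr; apply: (le_m) => r Cr; rewrite lerBlDr.
      (* Two members of the chain are comparable; subadditivity is applied to the smaller one. *)
      have [/asboolP qr|/asboolP rq] := Ctot q r Cq Cr.
        apply: (le_trans (m_le _ _ Cr)); apply: (le_trans ((svalP r).1.1 _ _)).
        by rewrite lerD2l.
      apply: (le_trans (m_le _ _ Cq)); apply: (le_trans ((svalP q).1.1 _ _)).
      by rewrite lerD2r.
    rewrite -ler_pdivrMl//; apply: (le_m) => q Cq; rewrite ler_pdivrMl//.
    by apply: (le_trans (m_le _ _ Cq)); exact: (svalP q).1.2.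
  have mp x : m x <= p x by apply: le_trans (m_le _ _ Cq0) _; exact: (svalP q0).2.
  by exists (exist _ m (conj sm mp)) => q Cq; apply/asboolP => x /=; exact: m_le.
exists q => // r hr rq.
have rp x : r x <= p x by exact: le_trans (rq x) (qp x).
have /= := qmin (exist _ r (conj hr rp)).
by move=> /(_ _)/(congr1 sval); apply; apply/asboolP.
Qed.

(* A minimal sublinear functional [q] equals all its tilts, which makes it
   additive. *)
Theorem hahn_banach p v : sublinear p -> exists2 f : {linear V -> R^o},
  (forall x, f x <= p x) & f v = p v.
Proof.
move=> hp.
(* Starting from the tilt of [p] along [v] forces [q (- v) <= - p v], hence the equality at [v]. *)
have [q [hq qp] qmin] := minimal_sublinear (sublinear_tilt v hp).
have qD x y : q (x + y) = q x + q y.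
  apply/eqP; rewrite eq_le hq.1/=.
  have := tilt_le y x hq (@ler01 _).
  rewrite (qmin _ (sublinear_tilt y hq)) => [|z]; last exact: tilt_le_id.
  by rewrite scale1r mul1r -lerBrDr.
have qN x : q (- x) = - q x.
  by apply/eqP; rewrite -addr_eq0 -qD addNr sublinear0.
have q_lin : linear (q : V -> R^o).
  move=> a x y; rewrite qD; congr (_ + _).
  have [a0|a0] := leP 0 a; first exact: sublinearZ.
  have := sublinearZ hq x (ltW (_ : 0 < - a)).
  by rewrite oppr_gt0 scaleNr qN => /(_ a0); rewrite mulNr => /oppr_inj.
pose f : {linear V -> R^o} := HB.pack (q : V -> R^o)
  (GRing.isLinear.Build R V R^o *:%R q q_lin).
have fp x : f x <= p x by exact: le_trans (qp x) (tilt_le_id _ _ hp).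
exists f => //; apply/eqP; rewrite eq_le fp/=.
have := le_trans (qp (- v)) (tilt_le v (- v) hp ler01).
by rewrite scale1r mul1r addNr sublinear0// sub0r qN lerN2.
Qed.

End HahnBanach.

(** * Order continuous Banach lattices *)

Section BanachLatticeTheory.
Context (R : realType) (E : banachLatticeType R).
Implicit Types x y z : E.

Lemma norm_vabs x : `|vabs x| = `|x|.
Proof.
have h : vabs (vabs x) = vabs x by rewrite vabs_id// vabs_ge0.
by apply/eqP; rewrite eq_le !le_lattice_norm ?h ?vle_refl.
Qed.

Lemma vle_norm x y : 0 <=L x -> x <=L y -> `|x| <= `|y|.
Proof.
by move=> x0 xy; rewrite le_lattice_norm// !vabs_id// (vle_ltrans x0).
Qed.

Lemma norm_vpos x : `|vpos x| <= `|x|.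
Proof.
by rewrite -(norm_vabs x) vle_norm ?vpos_ge0// vpos_le vle_abs vabs_ge0.
Qed.

(** The multiples of the positive part of [x] also stay below [y], so [n * |vpos x| <= |y|] in norm
    for all [n], and [vpos x = 0]. *)
Lemma vle0_archimedean x y : (forall n : nat, x *+ n <=L y) -> x <=L 0.
Proof.
move=> xy.
have y0 : 0 <=L y by have := xy 0.
have py n : vpos x *+ n <=L y.
  case: n => [|n]; first by rewrite mulr0n.
  have n0 : (0 : R) < n.+1%:R by rewrite ltr0n.
  rewrite -scaler_nat -subv_ge0.
  have -> : y - n.+1%:R *: vpos x = n.+1%:R *: (n.+1%:R^-1 *: y - vpos x).
    by rewrite scalerBr scalerA divff ?scale1r// gt_eqF.
  rewrite vscaler_ge0 ?subv_ge0 ?ltW// vpos_le.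
  rewrite (vscaler_ge0 _ _ _ y0) ?invr_ge0 ?ltW// andbT.
  rewrite -subv_ge0.
  have -> : n.+1%:R^-1 *: y - x = n.+1%:R^-1 *: (y - x *+ n.+1).
    by rewrite scalerBr -[x *+ n.+1]scaler_nat scalerA mulVf ?scale1r// gt_eqF.
  by rewrite vscaler_ge0 ?subv_ge0// invr_ge0 ltW.
suff -> : 0 = vpos x by exact: vle_pos.
apply/esym/eqP; rewrite -normr_eq0; apply/negPn/negP => n0.
have {}n0 : 0 < `|vpos x| by rewrite lt_neqAle eq_sym n0 normr_ge0.
set n := Num.bound (`|y| / `|vpos x|).
have : `|y| / `|vpos x| < n%:R by rewrite archi_boundP// divr_ge0.
rewrite ltr_pdivrMr// mulr_natl => /lt_geF.
rewrite -normrMn vle_norm//.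
by elim: n => [|n IH]; rewrite ?mulr0n ?vle_refl// mulrS addv_ge0 ?vpos_ge0.
Qed.

(* Extending [t x |-> t `|x|] below [z |-> `|vpos z|] rather than below the
   norm makes the extension positive. *)
Lemma norming_positive_functional x : 0 <=L x ->
  exists f : {linear E -> R^o}, [/\ continuous f, forall z, f z <= `|z|,
    forall z, 0 <=L z -> 0 <= f z & f x = `|x|].
Proof.
move=> x0.
have hp : sublinear (fun z => `|vpos z|).
  split=> [y z|a z a0].
    apply: le_trans (ler_normD _ _); apply: vle_norm; first exact: vpos_ge0.
    by rewrite vpos_le vleD ?vle_pos// addv_ge0 ?vpos_ge0.
  rewrite -[X in X * _]gtr0_norm// -normrZ; apply: vle_norm; first exact: vpos_ge0.
  rewrite vpos_le vscaler_ge0 ?vpos_ge0 1?ltW// andbT.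
  by rewrite -subv_ge0 -scalerBr vscaler_ge0 ?subv_ge0 ?vle_pos// ltW.
have [f fp fx] := hahn_banach x hp.
have f_le z : f z <= `|z| by exact: le_trans (fp z) (norm_vpos z).
exists f; split => // [|z z0|].
- apply/linear_bounded_continuous/linear_boundedP.
  exists 1; split => // r r1 z.
  apply: (@le_trans _ _ `|z|); last by rewrite ler_peMl// ltW.
  by rewrite ler_norml f_le andbT lerNl -linearN -[leRHS]normrN f_le.
- have := fp (- z); rewrite linearN.
  by rewrite vpos_eq0 ?normr0 ?oppr_le0// -[0]oppr0 vleN2.
- by rewrite fx vpos_id.
Qed.

(** * Gaps between a directed set and its upper bounds *)

Definition vub (S : set E) : set E := [set b | forall s, S s -> s <=L b].

(** Index type of a net. The condition is made boolean so that the pairs form a subtype, which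
    inherits the choice structure a preorder requires. *)
Definition gaps (S : set E) := {p : E * E | `[< S p.1 /\ vub S p.2 >]}.

Section Gaps.
Context (S : set E).

HB.instance Definition _ := Choice.on (gaps S).

Let gap_le (p q : gaps S) :=
  ((val p).1 <=L (val q).1) && ((val q).2 <=L (val p).2).

Let gap_le_refl : reflexive gap_le.
Proof. by move=> p; rewrite /gap_le !vle_refl. Qed.

Let gap_le_trans : transitive gap_le.
Proof.
move=> q p r /andP[pq qp] /andP[qr rq].
by rewrite /gap_le (vle_ltrans pq qr) (vle_ltrans rq qp).
Qed.

HB.instance Definition _ :=
  Order.Le_isPreorder.Build (Order.Disp tt tt) (gaps S) gap_le_refl gap_le_trans.

End Gaps.

Lemma tails_proper d (I : preorderType d) : directed I -> ProperFilter (tails I).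
Proof.
move=> [[i0] dir].
apply: filter_from_proper; last by move=> i _; exists i => /=.
apply: filter_from_filter; first by exists i0.
move=> i j _ _; have [k /andP[ik jk]] := dir i j; exists k => //= l /= kl.
by split; exact: le_trans kl.
Qed.

(* The net of all differences [b - s], [b] an upper bound of [S] and [s] in
   [S], decreases to [0] because [E] is Archimedean. *)
Lemma order_continuous_gap (S : set E) (e : R) : order_continuous E ->
  S !=set0 -> vub S !=set0 ->
  (forall s t, S s -> S t -> exists2 r, S r & s <=L r /\ t <=L r) ->
  0 < e -> exists s b, [/\ S s, vub S b & `|b - s| < e].
Proof.
move=> oc [s0 Ss0] [b0 Sb0] dirS e0.
have gapP (p : gaps S) : S (val p).1 /\ vub S (val p).2 by exact/asboolP/(valP p).
have mkgap s b (Ss : S s) (Sb : vub S b) : {p : gaps S | val p = (s, b)}.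
  have h : `[< S (s, b).1 /\ vub S (s, b).2 >] by exact/asboolP.
  by exists (exist _ (s, b) h).
have dirG : directed (gaps S).
  split; first by case: (mkgap _ _ Ss0 Sb0).
  move=> p q; have [Sp bp] := gapP p; have [Sq bq] := gapP q.
  have [r Sr [pr qr]] := dirS _ _ Sp Sq.
  have br : vub S (vmeet (val p).2 (val q).2) by move=> s Ss; rewrite vlexI bp// bq.
  have [g gE] := mkgap _ _ Sr br.
  by exists g; rewrite /Order.le/= gE/= pr qr vleIl vleIr.
have gap0 :
    (fun p : gaps S => (val p).2 - (val p).1) @ tails (gaps S) --> (0 : E).
  apply: oc => // [p q /andP[pq qp]|p|z hz].
  - by rewrite vleD// vleN2.
  - by have [Sp bp] := gapP p; rewrite subv_ge0 bp.
  (* If [z] is below every gap, then [b - z] is an upper bound whenever [b] is; by induction so is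
     [b0 - z *+ n], which is therefore above [s0]. *)
  - apply: (@vle0_archimedean _ (b0 - s0)) => n.
    rewrite vleBrDr addrC -vleBrDr.
    elim: n s0 Ss0 => [|n IH] s Ss; first by rewrite mulr0n subr0 Sb0.
    have bn : vub S (b0 - z *+ n) by [].
    have [g gE] := mkgap _ _ Ss bn.
    by have := hz g; rewrite gE/= mulrSr opprD addrA !vleBrDr (addrC s z).
have tailsP := tails_proper dirG.
have /cvgr0Pnorm_lt/(_ _ e0)[p _ hp] := gap0.
have [Sp bp] := gapP p.
by exists (val p).1, (val p).2; split => //; exact: hp (lexx p).
Qed.

Lemma near_weakly_cvg0 d (I : preorderType d) (x : I -> E)
    (F : I -> {linear E -> R^o}) (s : seq I) (e : R) :
  directed I -> weakly_cvg x 0 -> (forall i, continuous (F i)) -> 0 < e ->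
  \forall i \near tails I, forall k, k \in s -> F k (x i) < e.
Proof.
move=> /tails_proper tailsP hx cF e0; elim: s => [|k s IH].
  by apply: nearW.
have := hx (F k) (cF k); rewrite linear0 => /cvgr0Pnorm_lt/(_ _ e0) hk.
apply: filterS2 IH hk => i hs hk l; rewrite inE => /predU1P[->|/hs//].
exact: le_lt_trans (ler_norm _) hk.
Qed.

Lemma vle_sum_ord (y : nat -> E) m n : (forall i, 0 <=L y i) -> (m <= n)%N ->
  \sum_(i < m) y i <=L \sum_(i < n) y i.
Proof.
move=> y0 /subnK <-; elim: (n - m)%N => [|p IH]; first exact: vle_refl.
by rewrite addSn big_ord_recr/= (vle_ltrans IH)// -[X in X <=L _]addr0 vleD2lE.
Qed.

(* If the norms stay above [e], pick terms [y n] of the net of norm at least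
   [e] with norming functionals [f n] such that the later terms are negligible
   for the earlier functionals. Then [f k] is at most [c] on the supremum of
   the later terms, and at least [e] on every bound of [y k]: this keeps the
   upper bounds of the tails of [y] away from their lower bounds, which
   contradicts order continuity. The suprema need not exist, whence the use of
   upper bounds close to lower ones. *)
Lemma weakly_cvg0_norm d (I : preorderType d) (x : I -> E) (u : E) :
  order_continuous E -> directed I ->
  (forall i, 0 <=L x i) -> (forall i, x i <=L u) ->
  weakly_cvg x 0 -> x @ tails I --> (0 : E).
Proof.
move=> oc dirI x0 xu wx.
have tailsP := tails_proper dirI.
apply/cvgr0Pnorm_lt => e e0; apply: contrapT => hn.
have freq i : exists2 j, (i <= j)%O & e <= `|x j|.
  apply: contrapT => h; apply: hn; exists i => // j /= ij.
  by rewrite ltNge; apply/negP => ej; apply: h; exists j.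
have /choice[F hF] i := norming_positive_functional (x0 i).
(* Three errors of at most [c] arise below: two from the gaps and one from the sums [T m]. They
   would give [e < 3 * c]. *)
pose c := e / 4; have c0 : 0 < c by rewrite divr_gt0.
have step (s : seq I) : exists i, e <= `|x i| /\
    forall k, k \in s -> F k (x i) < c / 2 ^+ size s.
  have cF i : continuous (F i) by case: (hF i).
  have cs : 0 < c / 2 ^+ size s by rewrite divr_gt0// exprn_gt0.
  have [i _ hi] := near_weakly_cvg0 s dirI wx cF cs.
  by have [j ij ej] := freq i; exists j; split => //; exact: hi.
have /choice[next hnext] := step.
(* [l n] lists the first [n] chosen indices; its size supplies the tolerance [c / 2 ^+ n]. *)
pose l n := iter n (fun s => next s :: s) [::].
have size_l n : size (l n) = n by elim: n => //= n ->.
pose y n := x (next (l n)); pose f n := F (next (l n)).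
have y0 n : 0 <=L y n by exact: x0.
have yu n : y n <=L u by exact: xu.
have mem_l k n : (k < n)%N -> next (l k) \in l n.
  elim: n => // n IH; rewrite ltnS leq_eqVlt inE => /predU1P[->|/IH->].
    by rewrite eqxx.
  by rewrite orbT.
have fy k n : (k < n)%N -> f k (y n) < c / 2 ^+ n.
  by move=> /mem_l kn; have := (hnext (l n)).2 _ kn; rewrite size_l.
have f_mono k a b : a <=L b -> f k a <= f k b.
  rewrite -subv_ge0 => ab; rewrite -subr_ge0 -linearB.
  by have [_ _ h _] := hF (next (l k)); exact: h.
have f_close k a b : `|b - a| < c -> f k b < f k a + c.
  move=> ab; rewrite -ltrBlDl -linearB.
  by have [_ h _ _] := hF (next (l k)); exact: le_lt_trans (h _) ab.
(* [U] is directed downwards, so the gap lemma is applied to its opposite: it gives [b] in [U] and a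
   lower bound [- b1] of [U] at distance less than [c]. *)
pose U := [set b | exists k, forall n, (k <= n)%N -> y n <=L b].
have [|||s [b1 [[b [k kb] <-] b1U bb1]]] :=
    @order_continuous_gap [set - b | b in U] c oc _ _ _ c0.
- by exists (- u), u => //; exists 0%N.
- exists 0 => _ [b [k kb] <-]; rewrite -[0]oppr0 vleN2.
  exact: vle_ltrans (kb k (leqnn k)).
- move=> _ _ [a [k ka] <-] [b [m mb] <-]; exists (- vmeet a b).
    exists (vmeet a b) => //; exists (k + m)%N => n kmn.
    by rewrite vlexI ka ?mb//; apply: leq_trans kmn; rewrite ?leq_addl ?leq_addr.
  by rewrite !vleN2 vleIl vleIr.
(* The sums start after [k], where [f k] is small on every term: a geometric series bounds
   [f k (T m)] by [c]. *)
pose T m := \sum_(n < m) y (k.+1 + n)%N.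
have T_mono p q : (p <= q)%N -> T p <=L T q.
  exact: (@vle_sum_ord (fun i => y (k.+1 + i)%N)).
have fT m : f k (T m) <= c * (1 - 2 ^- m).
  elim: m => [|m IH]; first by rewrite /T big_ord0 linear0 expr0 invr1 subrr mulr0.
  rewrite /T big_ord_recr/= linearD.
  have := fy k (k.+1 + m)%N; rewrite leq_addr => /(_ isT).
  have : c / 2 ^+ (k.+1 + m) <= c / 2 ^+ m.+1.
    rewrite ler_pM2l// lef_pV2 ?posrE ?exprn_gt0//.
    by rewrite ler_eXn2l ?ltr1n// addSn ltnS leq_addl.
  move: IH; rewrite -/(T m) !mulrBr mulr1.
  have -> : c / 2 ^+ m = 2 * (c / 2 ^+ m.+1).
    by rewrite exprS invfM mulrCA mulVKf.
  by lra.
(* The bound [u] is imposed because the sums [T m] are not known to be order bounded. The set still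
   contains each [y n] with [n > k], so its upper bound [b'] lies in [U], above [- b1]. *)
have [|||t [b' [[_ [m tm]] b'S b't]]] :=
    @order_continuous_gap [set s | s <=L u /\ exists m, s <=L T m] c oc _ _ _ c0.
- exists 0; split; first exact: vle_ltrans (yu 0%N).
  by exists 0%N; rewrite /T big_ord0 vle_refl.
- by exists u => t [].
- move=> p q [pu [m pm]] [qu [n qn]]; exists (vjoin p q); last by rewrite vleUl vleUr.
  split; first by rewrite vleUx pu.
  exists (m + n)%N; rewrite vleUx (vle_ltrans pm) ?(vle_ltrans qn)//.
    exact: T_mono (leq_addl _ _).
  exact: T_mono (leq_addr _ _).
have b'U : U b'.
  exists k.+1 => n kn; apply: b'S; split => //.
  exists (n - k.+1).+1; rewrite /T big_ord_recr/= subnKC// -[X in X <=L _]add0r.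
  rewrite vleD2rE.
  by have := T_mono _ _ (leq0n (n - k.+1)); rewrite {1}/T big_ord0.
have b1b' : - b1 <=L b' by rewrite -[b']opprK vleN2 b1U//; exists b'.
have := f_mono k _ _ (kb k (leqnn k)).
have := f_close k (- b1) b; rewrite opprK addrC => /(_ _).
have := f_mono k _ _ b1b'.
have := f_close k _ _ b't.
have := f_mono k _ _ tm.
have : 0 <= c * 2 ^- m by rewrite mulr_ge0 ?invr_ge0 ?exprn_ge0// ltW.
have := fT m.
have [_ _ _ fk] := hF (next (l k)).
have := (hnext (l k)).1.
rewrite -{}fk -/(f k) -/(y k).
move: bb1; rewrite opprK addrC => bb1.
rewrite mulrBr mulr1 => h1 h2 h3 h4 h5 h6 /(_ bb1) h7 h8.
by have : c = e / 4 by []; lra.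
Qed.

End BanachLatticeTheory.

(** * Lattice bimorphisms and the Fremlin tensor product *)

Section LatticeHomTheory.
Context (R : realType) (E F : vectorLatticeType R) (T : E -> F).
Context (hT : lattice_hom T).
Implicit Types x y : E.

Lemma lattice_homB x y : T (x - y) = T x - T y.
Proof. by case: hT => h _ _; rewrite addrC -scaleN1r h scaleN1r addrC. Qed.

Lemma lattice_hom0 : T 0 = 0.
Proof. by rewrite -(subrr 0) lattice_homB subrr. Qed.

Lemma lattice_hom_le x y : x <=L y -> T x <=L T y.
Proof.
by move=> xy; case: hT => _ hU _; rewrite -(vjoin_idr xy) hU vleUl.
Qed.

Lemma lattice_hom_ge0 x : 0 <=L x -> 0 <=L T x.
Proof. by move=> /lattice_hom_le; rewrite lattice_hom0. Qed.

Lemma lattice_hom_abs x : vabs (T x) = T (vabs x).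
Proof.
case: hT => _ hU _.
by rewrite /vabs hU -[- x]sub0r lattice_homB lattice_hom0 sub0r.
Qed.

End LatticeHomTheory.

Lemma lattice_hom_bimorphism (R : realType) (E F A G : vectorLatticeType R)
    (t : E -> F -> A) (iota : A -> G) :
  lattice_hom iota -> lattice_bimorphism t ->
  lattice_bimorphism (fun x y => iota (t x y)).
Proof.
move=> [il iU iI] [[tl tr] hl hr]; split.
- by split=> [v a x y|u a x y]; rewrite ?tl ?tr il.
- move=> y y0; have [l U M] := hl y y0.
  split=> [a x z|x z|x z]; by [rewrite l il|rewrite U iU|rewrite M iI].
- move=> x x0; have [l U M] := hr x x0.
  split=> [a y z|y z|y z]; by [rewrite l il|rewrite U iU|rewrite M iI].
Qed.

Section BimorphismTheory.
Context (R : realType) (E F G : vectorLatticeType R) (t : E -> F -> G).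
Context (ht : lattice_bimorphism t).
Implicit Types (x u : E) (y v : F).

Let homl y : 0 <=L y -> lattice_hom (t^~ y).
Proof. by case: ht => _ h _; exact: h. Qed.

Let homr x : 0 <=L x -> lattice_hom (t x).
Proof. by case: ht => _ _ h; exact: h. Qed.

Lemma bimorphismDl x u y : t (x + u) y = t x y + t u y.
Proof. by case: ht => [[h _] _ _]; rewrite -[x]scale1r h !scale1r. Qed.

Lemma bimorphismDr x y v : t x (y + v) = t x y + t x v.
Proof. by case: ht => [[_ h] _ _]; rewrite -[y]scale1r h !scale1r. Qed.

Lemma bimorphismBr x y v : t x (y - v) = t x y - t x v.
Proof. by apply/eqP; rewrite eq_sym subr_eq -bimorphismDr subrK. Qed.

Lemma bimorphism_ge0 x y : 0 <=L x -> 0 <=L y -> 0 <=L t x y.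
Proof. by move=> x0 y0; exact: (lattice_hom_ge0 (homr x0)). Qed.

Lemma bimorphism_le x u y v : 0 <=L x -> 0 <=L y -> x <=L u -> y <=L v ->
  t x y <=L t u v.
Proof.
move=> x0 y0 xu yv; apply: (@vle_ltrans _ _ (t u y)).
  exact: (lattice_hom_le (homl y0)).
exact: lattice_hom_le (homr (vle_ltrans x0 xu)) _ _ yv.
Qed.

(** For [y = h - k] with positive parts, [t^~ h] and [t^~ k] commute with the modulus, and
    [h + k = vabs y]. *)
Lemma bimorphism_abs_le x y : vabs (t x y) <=L t (vabs x) (vabs y).
Proof.
have [h [k [h0 k0 -> ->]]] := pos_decomposition y.
rewrite bimorphismBr bimorphismDr (vle_ltrans (vabsD _ _))// vabsN.
by rewrite !(lattice_hom_abs (homl _))// vle_refl.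
Qed.

Lemma bimorphism_meetl x u y : 0 <=L y ->
  vmeet (t x y) (t u y) = t (vmeet x u) y.
Proof. by move=> y0; have [_ _ ->] := homl y0. Qed.

Lemma bimorphism_meetr x y v : 0 <=L x ->
  vmeet (t x y) (t x v) = t x (vmeet y v).
Proof. by move=> x0; have [_ _ ->] := homr x0. Qed.

(* With [n = y /\ v], the remainders [r = y - n] and [s = v - n] are disjoint,
   so [t x r] and [t u s] are disjoint as well. *)
Lemma bimorphism_meet_le x u y v : 0 <=L x -> 0 <=L u -> 0 <=L y -> 0 <=L v ->
  vmeet (t x y) (t u v) <=L t (vmeet x u) v + t u (vmeet y v).
Proof.
move=> x0 u0 y0 v0; set n := vmeet y v.
have n0 : 0 <=L n by rewrite vlexI y0.
pose r := y - n; pose s := v - n.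
have r0 : 0 <=L r by rewrite subv_ge0 vleIl.
have s0 : 0 <=L s by rewrite subv_ge0 vleIr.
have rs : vmeet r s = 0 by rewrite -vmeetDr subrr.
have -> : t x y = t x n + t x r by rewrite -bimorphismDr addrC subrK.
apply: vle_ltrans (vmeetD_le _ _ _) _; rewrite ?bimorphism_ge0//.
apply: (@vleD _ G).
  rewrite -bimorphism_meetl//; apply: vleI2; last exact: vle_refl.
  by apply: bimorphism_le; rewrite ?vle_refl// vleIr.
have -> : t u v = t u s + t u n by rewrite -bimorphismDr subrK.
apply: vle_ltrans (vmeetDl_le _ _ _) _; first exact: bimorphism_ge0.
rewrite -[X in _ <=L X]add0r vleD2rE.
have xxu := vleUl x u; have uxu := vleUr x u.
have xu0 : 0 <=L vjoin x u by exact: vle_ltrans xxu.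
apply: (@vle_ltrans _ _ (vmeet (t (vjoin x u) r) (t (vjoin x u) s))).
  by apply: vleI2; apply: bimorphism_le => //; exact: vle_refl.
by rewrite bimorphism_meetr// rs (lattice_hom0 (homr xu0)) vle_refl.
Qed.

(** The difference is dominated by [t a b + t a v + t u b]. Met with [t u v], the last two terms
    give one summand each and [t a b] gives one of both kinds, whence the factors [2]. *)
Lemma bimorphism_sub_meet_le x x0 u y y0 v : vabs x0 <=L u -> vabs y0 <=L v ->
  vmeet (vabs (t x y - t x0 y0)) (t u v) <=L
  t (vmeet (vabs (x - x0)) u) v *+ 2 + t u (vmeet (vabs (y - y0)) v) *+ 2.
Proof.
move=> x0u y0v; set a := vabs (x - x0); set b := vabs (y - y0).
have u0 : 0 <=L u := vle_ltrans (vabs_ge0 _) x0u.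
have v0 : 0 <=L v := vle_ltrans (vabs_ge0 _) y0v.
have a0 : 0 <=L a := vabs_ge0 _; have b0 : 0 <=L b := vabs_ge0 _.
have uv0 := bimorphism_ge0 u0 v0.
have : vabs (t x y - t x0 y0) <=L t a b + t a v + t u b.
  have -> : t x y - t x0 y0 = t (x - x0) (y - y0) + t (x - x0) y0 + t x0 (y - y0).
    rewrite -bimorphismDr subrK bimorphismBr addrA -bimorphismDl subrK //.
  apply: vle_ltrans (vabsD _ _) _; apply: (@vleD _ G).
    apply: vle_ltrans (vabsD _ _) _; apply: (@vleD _ G).
      exact: bimorphism_abs_le.
    apply: vle_ltrans (bimorphism_abs_le _ _) _.
    by apply: bimorphism_le; rewrite ?vabs_ge0 ?vle_refl.
  apply: vle_ltrans (bimorphism_abs_le _ _) _.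
  by apply: bimorphism_le; rewrite ?vabs_ge0 ?vle_refl.
move=> /vleI2 => /(_ _ _ (vle_refl (t u v))) h; apply: vle_ltrans h _.
have ab0 := bimorphism_ge0 a0 b0; have av0 := bimorphism_ge0 a0 v0.
have ub0 := bimorphism_ge0 u0 b0.
apply: vle_ltrans (vmeetD_le (addv_ge0 ab0 av0) ub0 uv0) _.
rewrite bimorphism_meetr// [X in _ <=L X + _]mulr2n [X in _ <=L _ + X]mulr2n.
rewrite addrA vleD2rE addrAC.
apply: vle_ltrans (vmeetD_le ab0 av0 uv0) _.
by rewrite bimorphism_meetl// vleD2rE bimorphism_meet_le.
Qed.

End BimorphismTheory.

(** The elements dominated by a single elementary tensor form a vector sublattice, because [t x1 y1
    + t x2 y2 <=L t (x1 + x2) (y1 + y2)] for positive arguments; it contains the generators. *)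
Lemma fremlin_tensor_dominated (R : realType) (E F A : vectorLatticeType R)
    (t : E -> F -> A) (w : A) : fremlin_tensor t ->
  exists x y, [/\ 0 <=L x, 0 <=L y & vabs w <=L t x y].
Proof.
case=> _ _ gen ht _.
pose S := [set w | exists x y, [/\ 0 <=L x, 0 <=L y & vabs w <=L t x y]].
suff ST : S = setT by have : S w by rewrite ST.
have S_le (z z1 z2 : A) : vabs z <=L vabs z1 + vabs z2 -> S z1 -> S z2 -> S z.
  move=> zz [x1 [y1 [x10 y10 h1]]] [x2 [y2 [x20 y20 h2]]].
  have x12 : 0 <=L x1 + x2 by exact: addv_ge0.
  have y12 : 0 <=L y1 + y2 by exact: addv_ge0.
  exists (x1 + x2), (y1 + y2); split => //.
  apply: vle_ltrans zz _; apply: vle_ltrans (vleD h1 h2) _.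
  rewrite (bimorphismDl ht); apply: (@vleD _ A).
    by apply: (bimorphism_le ht) => //; rewrite ?vle_refl// -[X in X <=L _]addr0 vleD2lE.
  by apply: (bimorphism_le ht) => //; rewrite ?vle_refl// -[X in X <=L _]add0r vleD2rE.
have S_scale (a : R) (z : A) : S z -> S (a *: z).
  move=> [x [y [x0 y0 h]]].
  have ax0 : 0 <=L `|a| *: x by rewrite vscaler_ge0.
  exists (`|a| *: x), y; split => //.
  have -> : t (`|a| *: x) y = `|a| *: t x y.
    case: ht => [[tl _] hl _]; have := tl y `|a| x 0.
    by rewrite addr0 (lattice_hom0 (hl _ y0)) addr0.
  have a0 : 0 <= `|a| := normr_ge0 a.
  have zh : z <=L t x y := vle_ltrans (vle_abs z) h.
  have Nzh : - z <=L t x y := vle_ltrans (vleN_abs z) h.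
  have : vabs (`|a| *: z) <=L `|a| *: t x y.
    by rewrite vabs_le -scalerN -!(subv_ge0 _ (_ *: _)) -!scalerBr !vscaler_ge0// subv_ge0.
  by have [_|_] := ger0P a; rewrite // scaleNr vabsN.
apply: gen => [|x y]; last first.
  exists (vabs x), (vabs y); split; [exact: vabs_ge0|exact: vabs_ge0|].
  exact: (bimorphism_abs_le ht).
have nn (z1 z2 : A) : [/\ z1 <=L vabs z1 + vabs z2, z2 <=L vabs z1 + vabs z2,
    - z1 <=L vabs z1 + vabs z2 & - z2 <=L vabs z1 + vabs z2].
  split; [rewrite -[X in X <=L _]addr0|rewrite -[X in X <=L _]add0r
    |rewrite -[X in X <=L _]addr0|rewrite -[X in X <=L _]add0r];
  by rewrite vleD ?vabs_ge0 ?vle_abs ?vleN_abs.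
split=> [|a z1 z2 S1 S2|z1 z2 S1 S2|z1 z2 S1 S2].
- exists 0, 0; split; rewrite ?vle_refl// vabs_id ?vle_refl//.
  by rewrite (bimorphism_ge0 ht)// vle_refl.
- by apply: S_le (vabsD _ _) (S_scale _ _ S1) S2.
- have [h1 h2 h3 h4] := nn z1 z2.
  apply: S_le S1 S2; rewrite vabs_le vleUx h1 h2/=.
  by apply: vle_ltrans h3; rewrite vleN2 vleUl.
- have [h1 h2 h3 h4] := nn z1 z2.
  apply: S_le S1 S2; rewrite vabs_le (vle_ltrans (vleIl _ _) h1)/=.
  by rewrite -vleN2 opprK vlexI -[X in _ && X]vleN2 -[X in X && _]vleN2 opprK h3 h4.
Qed.

Lemma pos_proj_norm_le (R : realType) (E F : banachLatticeType R)
    (A : vectorLatticeType R) (t : E -> F -> A) (x : E) (y : F) :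
  lattice_bimorphism t -> 0 <=L x -> 0 <=L y ->
  pos_proj_norm t (t x y) <= `|x| * `|y|.
Proof.
move=> ht x0 y0; apply: ge_inf.
  by exists 0 => _ [n [a [b [_ _ _ ->]]]]; apply: sumr_ge0 => i _; exact: mulr_ge0.
exists 1%N, (fun=> x), (fun=> y); split => //; last by rewrite big_ord1.
by rewrite big_ord1 vabs_id ?vle_refl// (bimorphism_ge0 ht).
Qed.

(** * Unbounded convergence and its passage to the tensor product *)

Lemma uaw_cvg_order_continuous (R : realType) (E : banachLatticeType R)
    (d : Order.disp_t) (I : preorderType d) (x : I -> E) (x0 u : E) (e : R) :
  order_continuous E -> directed I -> uaw_cvg x x0 -> 0 <=L u -> 0 < e ->
  exists i0, forall i, (i0 <= i)%O -> `|vmeet (vabs (x i - x0)) u| < e.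
Proof.
move=> oc dirI hx u0 e0; have tailsP := tails_proper dirI.
have p0 i : 0 <=L vmeet (vabs (x i - x0)) u by rewrite vlexI vabs_ge0.
have pu i : vmeet (vabs (x i - x0)) u <=L u by exact: vleIr.
have /cvgr0Pnorm_lt/(_ _ e0)[i0 _ hi0] := weakly_cvg0_norm oc dirI p0 pu (hx u u0).
by exists i0 => i /hi0.
Qed.

Theorem theorem7 (R : realType) (E F G : banachLatticeType R)
    (tensor : E -> F -> G)
    (hG : fremlin_projective_tensor tensor)
    (ocE : order_continuous E) (ocF : order_continuous F)
    (dI dJ : Order.disp_t) (I : preorderType dI) (J : preorderType dJ)
    (dirI : directed I) (dirJ : directed J)
    (x : I -> E) (x0 : E) (y : J -> F) (y0 : F)
    (hx : uaw_cvg x x0) (hy : uaw_cvg y y0) :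
  uaw_cvg (fun ij : I *p J => tensor (x ij.1) (y ij.2)) (tensor x0 y0).
Proof.
have [A [tA [iota [hA hiota normi densei tensorE]]]] := hG.
have htA : lattice_bimorphism tA by case: hA.
have ht : lattice_bimorphism tensor.
  have -> : tensor = fun a b => iota (tA a b).
    by apply/funext => a; apply/funext => b; exact: tensorE.
  exact: lattice_hom_bimorphism.
have norm_tensor a b : 0 <=L a -> 0 <=L b -> `|tensor a b| <= `|a| * `|b|.
  by move=> a0 b0; rewrite tensorE normi pos_proj_norm_le.
move=> w w0 f cf.
have dirIJ : directed (I *p J).
  case: dirI dirJ => [[i0] di] [[j0] dj]; split; first by exists; exact: (i0, j0).
  move=> [i j] [i' j']; have [k /andP[ik ik']] := di i i'.
  have [l /andP[jl jl']] := dj j j'.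
  by exists (k, l); rewrite !Order.ProdOrder.leEprod/= ik ik' jl jl'.
have tailsP := tails_proper dirIJ.
suff cvg0 : (fun ij : I *p J => vmeet (vabs (tensor (x ij.1) (y ij.2) - tensor x0 y0)) w)
    @ tails (I *p J) --> (0 : G) by exact: cvg_comp cvg0 (cf 0).
apply/cvgr0Pnorm_lt => e e0.
have [v iota_v] : exists v, `|w - iota v| < e / 4.
  have e40 : 0 < e / 4 by rewrite divr_gt0.
  have [|z [zw [v _ vz]]] := densei (ball w (e / 4)) _ (ball_open _ _).
    by exists w; exact: ballxx.
  by exists v; rewrite vz; move: zw; rewrite -ball_normE.
have [a [b [a0 b0 vab]]] := fremlin_tensor_dominated v hA.
(* Enlarging [a] and [b] makes [u] and [u'] dominate the moduli of the limits too, as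
   [bimorphism_sub_meet_le] requires. *)
pose u := a + vabs x0; pose u' := b + vabs y0.
have u0 : 0 <=L u by rewrite addv_ge0 ?vabs_ge0.
have u'0 : 0 <=L u' by rewrite addv_ge0 ?vabs_ge0.
have x0u : vabs x0 <=L u by rewrite -[X in X <=L _]add0r vleD2rE.
have y0u' : vabs y0 <=L u' by rewrite -[X in X <=L _]add0r vleD2rE.
have w_le : w <=L tensor u u' + vabs (w - iota v).
  rewrite -[X in X <=L _](subrK (iota v)) addrC.
  apply: (@vleD _ G); last exact: vle_abs.
  apply: vle_ltrans (vle_abs _) _; rewrite (lattice_hom_abs hiota).
  apply: vle_ltrans (lattice_hom_le hiota vab) _; rewrite -tensorE.
  by apply: (bimorphism_le ht); rewrite // -[X in X <=L _]addr0 vleD2lE vabs_ge0.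
(* The doubled tensor terms then contribute at most [e / 4] and the approximation of [w] less than
   [e / 4]; the [+ 1] keeps the denominator positive. *)
pose e1 := e / (8 * (`|u| + `|u'| + 1)).
have e10 : 0 < e1 by rewrite divr_gt0// mulr_gt0// ltr_wpDl// addr_ge0.
have [i0 hi0] := uaw_cvg_order_continuous ocE dirI hx u0 e10.
have [j0 hj0] := uaw_cvg_order_continuous ocF dirJ hy u'0 e10.
exists (i0, j0) => // -[i j]; rewrite /= Order.ProdOrder.leEprod/= => /andP[ii jj].
have {}hi0 := hi0 _ ii; have {}hj0 := hj0 _ jj.
set p := vmeet (vabs (x i - x0)) u in hi0 *.
set q := vmeet (vabs (y j - y0)) u' in hj0 *.
have p0 : 0 <=L p by rewrite vlexI vabs_ge0.
have q0 : 0 <=L q by rewrite vlexI vabs_ge0.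
set z := vabs _.
have : vmeet z w <=L tensor p u' *+ 2 + tensor u q *+ 2 + vabs (w - iota v).
  apply: (@vle_ltrans _ _ (vmeet z (tensor u u' + vabs (w - iota v)))).
    by apply: vleI2 w_le; exact: vle_refl.
  apply: vle_ltrans (vmeetDl_le _ _ (vabs_ge0 _)) _; rewrite vleD2rE.
  exact: bimorphism_sub_meet_le.
have zw0 : 0 <=L vmeet z w by rewrite vlexI vabs_ge0.
move=> /(vle_norm zw0) /le_lt_trans; apply.
have := ler_normD (tensor p u' *+ 2 + tensor u q *+ 2) (vabs (w - iota v)).
have := ler_normD (tensor p u' *+ 2) (tensor u q *+ 2).
rewrite !normrMn norm_vabs.
have := norm_tensor _ _ p0 u'0.
have := norm_tensor _ _ u0 q0.
have : `|p| * `|u'| <= e1 * `|u'| by rewrite ler_wpM2r// ltW.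
have : `|u| * `|q| <= e1 * `|u| by rewrite mulrC ler_wpM2r// ltW.
have : e1 * (`|u| + `|u'| + 1) = e / 8.
  rewrite /e1 invfM mulrA mulfVK// gt_eqF// ltr_wpDl// addr_ge0//.
rewrite !mulrDr mulr1.
lra.
Qed.
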